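(* Let $(U,\mu)$ be a fuzzy Hilbert space (satisfying the standing assumptions in the context), let $K$ be a strongly fuzzy bounded linear operator on $U$, let $\{f_i\}_{i=1}^\infty$ be a fuzzy $K$-frame for $U$ with bounds $A,B$, and let $T$ be a strongly fuzzy bounded linear operator on $U$ such that $TT^*=I$ (the identity on $U$) and $TK=KT$. Then $\{Tf_i\}_{i=1}^\infty$ is a fuzzy $K$-frame for $U$.
   Context: Let $U$ be a complex vector space with zero vector $\theta$. A fuzzy inner product on $U$ is a map $\mu:U\times U\times\mathbb C\to[0,1]$ such that for all $x,y,z\in U$, $s,t\in\mathbb C$: (FIP1) $\mu(x+y,z,|t|+|s|)\ge\min\{\mu(x,z,|t|),\mu(y,z,|s|)\}$; (FIP2) $\mu(x,y,|st|)\ge\min\{\mu(x,x,|s|^2),\mu(y,y,|t|^2)\}$; (FIP3) $\mu(x,y,t)=\mu(y,x,\overline t)$; (FIP4) $\mu(cx,y,t)=\mu(x,y,t/|c|)$ for $c\in\mathbb C\setminus\{0\}$; (FIP5) $\mu(x,x,t)=0$ for $t\in\mathbb C\setminus\mathbb R^+$; (FIP6) $\mu(x,x,t)=1$ for all $t>0$ iff $x=\theta$; (FIP7) $\mu(x,x,\cdot):\mathbb R\to[0,1]$ is non-decreasing with limit $1$ at $+\infty$. Put $N(x,t)=\mu(x,x,t^2)$ for $t>0$ and $N(x,t)=0$ for real $t\le0$. Standing assumptions: (FIP8) if $\mu(x,x,t^2)>0$ for all $t>0$ then $x=\theta$; (FIP9) the norms $\|x\|_\alpha=\inf\{t>0:N(x,t)\ge\alpha\}$,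 $\alpha\in(0,1)$ (the $\alpha$-norms, an ascending family of norms on $U$), satisfy the parallelogram law. Let $\langle\cdot,\cdot\rangle_\alpha$ be the inner product obtained from $\|\cdot\|_\alpha$ by polarization. $(U,\mu)$ is a fuzzy Hilbert space if $U$ is complete with respect to $\|\cdot\|_\alpha$ for every $\alpha\in(0,1)$. A linear operator $T$ on $U$ is strongly fuzzy bounded if there is $M>0$ with $N(Tx,s)\ge N(x,s/M)$ for all $x\in U,s\in\mathbb R$ (equivalently $\|Tx\|_\alpha\le M\|x\|_\alpha$ for all $x$ and all $\alpha\in(0,1)$, for some $M>0$). Every strongly fuzzy bounded linear operator $T$ on $U$ under consideration is taken to possess an adjoint $T^*$: a strongly fuzzy bounded linear operator on $U$ with $\langle x,Ty\rangle_\alpha=\langle T^*x,y\rangle_\alpha$ for all $x,y\in U$ and all $\alpha\in(0,1)$. For a strongly fuzzy bounded linear operator $K$ on $U$, a sequence $\{f_i\}_{i=1}^\infty$ in $U$ is a fuzzy $K$-frame for $U$ (with bounds $A,B$) if there are constants $0<A\le B<\infty$ with $A\|K^*f\|_\alpha^2\le\sum_{i=1}^\infty|\langle f,f_i\rangle_\alpha|^2\le B\|f\|_\alpha^2$ for all $f\in U$ and all $\alpha\in(0,1)$. *)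

(* Defs.v *)
From HB Require Import structures.
From mathcomp Require Import all_boot all_order all_algebra.
From mathcomp Require Import all_classical all_reals all_analysis.
From mathcomp Require Import complex.

Set Implicit Arguments.
Unset Strict Implicit.
Unset Printing Implicit Defensive.

Import Order.TTheory GRing.Theory Num.Theory.
Import numFieldNormedType.Exports.

Local Open Scope classical_set_scope.
Local Open Scope complex_scope.
Local Open Scope ring_scope.

(* On [R[i]], the norm [`|z|] is complex-valued (a nonnegative real seen in
   [R[i]]), and [0 < z] means that [z] is real and positive; thus the set
   of positive reals is [[set t : R[i] | 0 < t]]. *)
Record fuzzy_inner_product (R : realType) (U : lmodType R[i])
    (mu : U -> U -> R[i] -> R) : Prop := FuzzyInnerProduct {
  fip_range : forall x y (t : R[i]), 0 <= mu x y t <= 1;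
  fip1 : forall x y z (s t : R[i]),
    Num.min (mu x z `|t|) (mu y z `|s|) <= mu (x + y) z (`|t| + `|s|);
  fip2 : forall x y (s t : R[i]),
    Num.min (mu x x (`|s| ^+ 2)) (mu y y (`|t| ^+ 2)) <= mu x y `|s * t|;
  fip3 : forall x y (t : R[i]), mu x y t = mu y x (conjc t);
  fip4 : forall (c : R[i]) x y (t : R[i]),
    c != 0 -> mu (c *: x) y t = mu x y (t / `|c|);
  fip5 : forall x (t : R[i]), ~~ (0 < t) -> mu x x t = 0;
  fip6 : forall x, (forall t : R, 0 < t -> mu x x t%:C = 1) <-> x = 0;
  fip7_nondecreasing : forall x (s t : R),
    s <= t -> mu x x s%:C <= mu x x t%:C;
  fip7_cvg : forall x, mu x x t%:C @[t --> +oo%R] --> (1 : R)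
}.

Definition fuzzy_norm (R : realType) (U : lmodType R[i])
    (mu : U -> U -> R[i] -> R) (x : U) (t : R) : R :=
  if 0 < t then mu x x (t ^+ 2)%:C else 0.

Definition alpha_norm (R : realType) (U : lmodType R[i])
    (mu : U -> U -> R[i] -> R) (alpha : R) (x : U) : R :=
  inf [set t : R | 0 < t /\ alpha <= fuzzy_norm mu x t].

(* Complex polarization identity, linear in the first argument. *)
Definition alpha_inner (R : realType) (U : lmodType R[i])
    (mu : U -> U -> R[i] -> R) (alpha : R) (x y : U) : R[i] :=
  let sq z := (alpha_norm mu alpha z ^+ 2)%:C in
  ((sq (x + y) - sq (x - y))
    + 'i%C * (sq (x + 'i%C *: y) - sq (x - 'i%C *: y))) / 4%:R.

Definition alpha_cauchy (R : realType) (U : lmodType R[i])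
    (mu : U -> U -> R[i] -> R) (alpha : R) (u : nat -> U) : Prop :=
  forall e : R, 0 < e -> exists n0 : nat, forall m n : nat,
    (n0 <= m)%N -> (n0 <= n)%N -> alpha_norm mu alpha (u m - u n) < e.

Definition alpha_complete (R : realType) (U : lmodType R[i])
    (mu : U -> U -> R[i] -> R) (alpha : R) : Prop :=
  forall u : nat -> U, alpha_cauchy mu alpha u ->
    exists l : U, alpha_norm mu alpha (u n - l) @[n --> \oo] --> (0 : R).

Record fuzzy_hilbert_space (R : realType) (U : lmodType R[i])
    (mu : U -> U -> R[i] -> R) : Prop := FuzzyHilbertSpace {
  fuzzy_hilbert_fip : fuzzy_inner_product mu;
  fip8 : forall x, (forall t : R, 0 < t -> 0 < mu x x (t ^+ 2)%:C) -> x = 0;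
  fip9 : forall alpha : R, 0 < alpha < 1 -> forall x y,
    alpha_norm mu alpha (x + y) ^+ 2 + alpha_norm mu alpha (x - y) ^+ 2
    = 2%:R * (alpha_norm mu alpha x ^+ 2 + alpha_norm mu alpha y ^+ 2);
  fuzzy_hilbert_complete : forall alpha : R, 0 < alpha < 1 ->
    alpha_complete mu alpha
}.

Definition strongly_fuzzy_bounded (R : realType) (U : lmodType R[i])
    (mu : U -> U -> R[i] -> R) (T : {linear U -> U}) : Prop :=
  exists2 M : R, 0 < M &
    forall x (s : R), fuzzy_norm mu x (s / M) <= fuzzy_norm mu (T x) s.

Definition is_fuzzy_adjoint (R : realType) (U : lmodType R[i])
    (mu : U -> U -> R[i] -> R) (T Tstar : {linear U -> U}) : Prop :=
  strongly_fuzzy_bounded mu Tstar /\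
  forall alpha : R, 0 < alpha < 1 -> forall x y,
    alpha_inner mu alpha x (T y) = alpha_inner mu alpha (Tstar x) y.

(* The witness [Kstar] is unique, as each [alpha_inner mu alpha] is an inner
   product on a fuzzy Hilbert space.  The series has nonnegative terms, so it
   is summed in the extended reals; the upper bound forces its convergence.
   The index [i = 1, 2, ...] is shifted to start at [0]. *)
Definition fuzzy_K_frame_bounds (R : realType) (U : lmodType R[i])
    (mu : U -> U -> R[i] -> R) (K : {linear U -> U}) (f_ : nat -> U)
    (A B : R) : Prop :=
  0 < A <= B /\
  exists2 Kstar : {linear U -> U}, is_fuzzy_adjoint mu K Kstar &
  forall (g : U) (alpha : R), 0 < alpha < 1 ->
    let S := (\sum_(0 <= i <oo)
      ((ComplexField.Normc.normc (alpha_inner mu alpha g (f_ i))) ^+ 2)%:E)%E in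
    ((A * alpha_norm mu alpha (Kstar g) ^+ 2)%:E <= S)%E /\
    (S <= (B * alpha_norm mu alpha g ^+ 2)%:E)%E.

Definition fuzzy_K_frame (R : realType) (U : lmodType R[i])
    (mu : U -> U -> R[i] -> R) (K : {linear U -> U}) (f_ : nat -> U) : Prop :=
  exists A B : R, fuzzy_K_frame_bounds mu K f_ A B.

(* Main.v *)
(* Since T T^* = I, the operator T^* preserves every alpha-norm, and
   <g, T f_i> = <T^* g, f_i>. So the frame inequalities at T^* g bound the new
   series above by B |g|^2 and below by A |K^* T^* g|^2. As T K = K T gives
   <K^* T^* g, y> = <T^* K^* g, y> for all y, one has
   |K^* T^* g| = |T^* K^* g| = |K^* g|, and the bounds A, B are unchanged. *)

Require Import Defs.
From HB Require Import structures.
From mathcomp Require Import all_boot all_order all_algebra.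
From mathcomp Require Import all_classical all_reals all_analysis.
From mathcomp Require Import complex ring lra.

Set Implicit Arguments.
Unset Strict Implicit.
Unset Printing Implicit Defensive.

Import Order.TTheory GRing.Theory Num.Theory.

Local Open Scope complex_scope.
Local Open Scope ring_scope.

Section AlphaNorm.
Variables (R : realType) (U : lmodType R[i]) (mu : U -> U -> R[i] -> R).
Hypothesis hU : fuzzy_hilbert_space mu.

(** FIP4 scales the first argument only; FIP3 swaps the arguments so that it reaches the second too,
    and the two conjugations of [t] cancel. *)
Lemma alpha_norm_unimodular (alpha : R) (c : R[i]) (x : U) :
  `|c| = 1 -> alpha_norm mu alpha (c *: x) = alpha_norm mu alpha x.
Proof.
move=> c1; have c0 : c != 0 by rewrite -normr_eq0 c1 oner_eq0.
have hmu := fuzzy_hilbert_fip hU.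
suff eqN : fuzzy_norm mu (c *: x) = fuzzy_norm mu x.
  by rewrite /alpha_norm eqN.
apply/funext => t; rewrite /fuzzy_norm; case: ifP => // _.
rewrite (fip4 hmu) // c1 divr1 (fip3 hmu) (fip4 hmu) // c1 divr1 (fip3 hmu).
by rewrite conjcK.
Qed.

Lemma alpha_normN (alpha : R) (x : U) :
  alpha_norm mu alpha (- x) = alpha_norm mu alpha x.
Proof. by rewrite -scaleN1r alpha_norm_unimodular // normrN1. Qed.

Lemma Re_alpha_inner (alpha : R) (x y : U) :
  complex.Re (alpha_inner mu alpha x y) =
  (alpha_norm mu alpha (x + y) ^+ 2 - alpha_norm mu alpha (x - y) ^+ 2) / 4%:R.
Proof.
rewrite /alpha_inner.
(* With the scalar real, the ['i] part of the polarization contributes nothing to [Re]. *)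
have -> : 4%:R^-1 = (4%:R^-1)%:C :> R[i].
  by rewrite fmorphV rmorph_nat.
by rewrite /=; ring.
Qed.

Lemma Re_alpha_innerC (alpha : R) (x y : U) :
  complex.Re (alpha_inner mu alpha x y) = complex.Re (alpha_inner mu alpha y x).
Proof. by rewrite !Re_alpha_inner (addrC x) -(alpha_normN _ (x - y)) opprB. Qed.

Lemma Re_alpha_inner_self (alpha : R) (x : U) : 0 < alpha < 1 ->
  complex.Re (alpha_inner mu alpha x x) = alpha_norm mu alpha x ^+ 2.
Proof.
move=> ha; rewrite Re_alpha_inner.
(* The parallelogram law at [0, 0] forces |0| = 0; at [x, x] it then gives |x + x|^2 = 4 |x|^2. *)
have := fip9 hU ha x x; have := fip9 hU ha 0 0.
by rewrite !subrr addr0; lra.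
Qed.

(* Since Re <u, v> = Re <v, u>, testing on [y := u] and [y := v] suffices, and
   additivity of the polarized form is not needed. *)
Lemma alpha_norm_sq_weak_eq (alpha : R) (u v : U) : 0 < alpha < 1 ->
  (forall y, alpha_inner mu alpha u y = alpha_inner mu alpha v y) ->
  alpha_norm mu alpha u ^+ 2 = alpha_norm mu alpha v ^+ 2.
Proof.
move=> ha uv.
by rewrite -!Re_alpha_inner_self // uv Re_alpha_innerC uv.
Qed.

(** Real parts of <T^* x, T^* x> = <x, T T^* x> = <x, x>. *)
Lemma alpha_norm_sq_coisometry_adjoint (T Tstar : {linear U -> U}) (alpha : R)
    (x : U) :
  is_fuzzy_adjoint mu T Tstar -> (forall y, T (Tstar y) = y) -> 0 < alpha < 1 ->
  alpha_norm mu alpha (Tstar x) ^+ 2 = alpha_norm mu alpha x ^+ 2.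
Proof.
move=> [_ adjT] TT ha.
by rewrite -!Re_alpha_inner_self // -adjT // TT.
Qed.

End AlphaNorm.

Theorem theorem4p5 (R : realType) (U : lmodType R[i])
    (mu : U -> U -> R[i] -> R)
    (K T Tstar : {linear U -> U}) (f_ : nat -> U) (A B : R)
    (hU : fuzzy_hilbert_space mu)
    (hK : strongly_fuzzy_bounded mu K)
    (hT : strongly_fuzzy_bounded mu T)
    (hTstar : is_fuzzy_adjoint mu T Tstar)
    (hf : fuzzy_K_frame_bounds mu K f_ A B)
    (hTT : forall x : U, T (Tstar x) = x)
    (hTK : forall x : U, T (K x) = K (T x)) :
  fuzzy_K_frame mu K (fun i => T (f_ i)).
Proof.
case: hf => AB [Kstar adjK frame]; exists A, B; split=> //.
exists Kstar => // g alpha ha S.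
have [_ adjKE] := adjK; have [_ adjTE] := hTstar.
have [lower upper] := frame (Tstar g) alpha ha.
have -> : S = (\sum_(0 <= i <oo) ((ComplexField.Normc.normc
    (alpha_inner mu alpha (Tstar g) (f_ i))) ^+ 2)%:E)%E.
  by apply: eq_eseriesr => i _; rewrite adjTE.
have normT x := alpha_norm_sq_coisometry_adjoint hU x hTstar hTT ha.
split; last by rewrite -normT.
rewrite -normT (@alpha_norm_sq_weak_eq _ _ _ hU _ _ (Kstar (Tstar g))) //.
(* Moving all adjoints to the right turns <T^* K^* g, y> into <g, K T y> and <K^* T^* g, y> into <g,
   T K y>. *)
by move=> y; rewrite -adjTE // -!adjKE // -adjTE // hTK.
Qed.
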